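(* Let $d\ge 1$, $q\ge 1$, let $X_{\mathcal F}\subset [q]^{\mathbb Z^d}$ be a shift space, let $U\subset\mathbb Z^d$ be finite, and let $u^{(0)},u^{(1)}\in \mathcal B_U(X_{\mathcal F})$ be patterns that are mutually replaceable in $X_{\mathcal F}$. Then for all finite sets $S\subset \mathbb Z^d$ there is a bijection between $\mathcal B_S(X_{\mathcal F},u^{(0)})$ and $\mathcal B_S(X_{\mathcal F},u^{(1)})$.
   Context: $[q]=\{0,\dots,q-1\}$. A pattern on a set $S\subset\mathbb Z^d$ is an element of $[q]^S$. For $u\in[q]^U$ and $i\in\mathbb Z^d$, the translate $\sigma^{-i}(u)\in[q]^{i+U}$ is given by $(\sigma^{-i}(u))_j=u_{j-i}$. For a configuration or pattern $w$ whose support contains $i+U$, one writes $w|_{i+U}=u$ to mean $w|_{i+U}=\sigma^{-i}(u)$; $u$ appears in $w$ if this holds for some $i$ with $i+U$ contained in the support of $w$. The shift space $X_{\mathcal F}$ is the set of all $x\in[q]^{\mathbb Z^d}$ in which no pattern from the list $\mathcal F$ (of patterns with finite support, finite or infinite list) appears. $\mathcal B_S(X_{\mathcal F})=\{x|_S: x\in X_{\mathcal F}\}$ and $\mathcal B_S(X_{\mathcal F},u)=\{x|_S : x\in X_{\mathcal F}\text{ and }u\text{ does not appear in }x|_S\}$. For $u^{(0)},u^{(1)}\in\mathcal B_U(X_{\mathcal F})$, $u^{(0)}$ can be replaced by $u^{(1)}$ in $X_{\mathcal F}$ if for all $x\in X_{\mathcal F}$ and every set $I\subset\mathbb Z^d$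 with $x|_{i+U}=u^{(0)}$ for all $i\in I$, there is $y\in X_{\mathcal F}$ such that $y|_{i+U}=u^{(1)}$ for all $i\in I$ and $y$ equals $x$ on $\mathbb Z^d\setminus\bigcup_{i\in I}(i+U)$. The patterns $u^{(0)},u^{(1)}$ are mutually replaceable in $X_{\mathcal F}$ if each can be replaced by the other in $X_{\mathcal F}$. *)

(* Defs.v *)
From mathcomp Require Import all_boot all_order all_algebra finmap.
From mathcomp Require Import boolp classical_sets functions.

Set Implicit Arguments.
Unset Strict Implicit.
Unset Printing Implicit Defensive.

Import GRing.Theory.

Local Open Scope classical_set_scope.
Local Open Scope ring_scope.

Definition Zd (d : nat) := 'rV[int]_d.

Definition config (d q : nat) := Zd d -> 'I_q.

(* [q]^S for a finite S; the alphabet {0, ..., q-1} is 'I_q *)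
Definition patt (d q : nat) (S : {fset Zd d}) := {ffun S -> 'I_q}.

Definition some_patt (d q : nat) := {V : {fset Zd d} & patt q V}.

Definition restr (d q : nat) (x : config d q) (S : {fset Zd d}) :
  patt q S := [ffun j : S => x (val j)].

(* x|_{i+U} = sigma^{-i}(u) for a configuration x: x_{i+j} = u_j for j in U *)
Definition occurs_at (d q : nat) (U : {fset Zd d}) (u : patt q U)
    (x : config d q) (i : Zd d) : Prop :=
  forall j : U, x (i + val j) = u j.

Definition appears_config (d q : nat) (U : {fset Zd d}) (u : patt q U)
    (x : config d q) : Prop :=
  exists i : Zd d, occurs_at u x i.

(* i + U is contained in S and w|_{i+U} = sigma^{-i}(u), for a pattern w on S:
   each i + j, j in U, is a point k of S, and w_k = u_j *)
Definition occurs_in_patt_at (d q : nat) (U : {fset Zd d})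
    (u : patt q U) (S : {fset Zd d}) (w : patt q S) (i : Zd d) :
    Prop :=
  forall j : U, exists2 k : S, val k = i + val j & w k = u j.

Definition appears_patt (d q : nat) (U : {fset Zd d}) (u : patt q U)
    (S : {fset Zd d}) (w : patt q S) : Prop :=
  exists i : Zd d, occurs_in_patt_at u w i.

(* The list of forbidden patterns is an arbitrary (finite or infinite) set of
   patterns with finite support. *)
Definition shift_space (d q : nat) (F : set (some_patt d q)) :
    set (config d q) :=
  [set x | forall p, F p -> ~ appears_config (projT2 p) x].

Definition language (d q : nat) (X : set (config d q))
    (S : {fset Zd d}) : set (patt q S) :=
  [set restr x S | x in X].
Arguments language {d q} X S _.

Definition language_avoiding (d q : nat) (X : set (config d q))
    (S U : {fset Zd d}) (u : patt q U) : set (patt q S) :=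
  [set restr x S | x in [set x | X x /\ ~ appears_patt u (restr x S)]].
Arguments language_avoiding {d q} X S {U} u _.

Definition translate (d : nat) (i : Zd d) (U : {fset Zd d}) :
    set (Zd d) :=
  [set i + j | j in [set` U]].

Definition replaceable (d q : nat) (X : set (config d q))
    (U : {fset Zd d}) (u0 u1 : patt q U) : Prop :=
  forall (x : config d q) (I : set (Zd d)),
    X x -> (forall i, I i -> occurs_at u0 x i) ->
    exists y : config d q,
      [/\ X y,
          (forall i, I i -> occurs_at u1 y i) &
          (forall j, (~` \bigcup_(i in I) translate i U) j -> y j = x j)].

Definition mutually_replaceable (d q : nat) (X : set (config d q))
    (U : {fset Zd d}) (u0 u1 : patt q U) : Prop :=
  replaceable X u0 u1 /\ replaceable X u1 u0.

(* Main.v *)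
Require Import Defs.
From mathcomp Require Import all_boot all_order all_algebra finmap.
From mathcomp Require Import boolp classical_sets functions.

(** The proof is an inclusion-exclusion over sets of marked occurrences.

    Fix a set J of positions.  Replacing by u1 all the occurrences of u0 at J at
    once turns a word of the language over S that has u0 at every position of J
    into one that has u1 there.  Outside the union of the translates of U by J
    the word is kept, and inside that union it was prescribed by u0, so this
    operation is injective ([card_occurrences_le]).  Mutual replaceability gives
    both inequalities: for every J, as many words have u0 (at least) at J as
    have u1 (at least) at J.  Overlaps between translates do no harm, because
    replaceability treats all the positions of J simultaneously.

    The counts of the words whose occurrence set contains J, for all J,
    determine the counts of the words whose occurrence set is exactly J
    ([card_fiber_from_upper_counts]); at J empty this compares the words
    avoiding u0 with those avoiding u1.  Equality of two finite cardinalities is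
    then a bijection.

    If U is nonempty, a point j0 of U encodes each position i with i + U inside
    S by the point i + j0 of S, so that positions range over a finite type.  If
    U is empty there is only one pattern on U, and the identity works. *)

Set Implicit Arguments.
Unset Strict Implicit.
Unset Printing Implicit Defensive.

Import GRing.Theory.

(** The bijection matches the enumerations of the two sets; the default value
    of [nth] is not reached on A because the enumerations have the same length. *)
Lemma set_bij_of_card_eq (T : finType) (A B : {set T}) :
  #|A| = #|B| -> exists f : T -> T, set_bij [set` A]%classic [set` B]%classic f.
Proof.
move=> eqAB; exists (fun x => nth x (enum B) (index x (enum A))).
have idx_lt x : x \in A -> index x (enum A) < size (enum B).
  by move=> xA; rewrite -cardE -eqAB cardE index_mem mem_enum.
split.
- by move=> x /= xA; rewrite -mem_enum mem_nth ?idx_lt.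
- move=> x y; rewrite !inE /= => xA yA.
  rewrite (set_nth_default x y) ?idx_lt // => /eqP.
  rewrite nth_uniq ?enum_uniq ?idx_lt // => /eqP eq_idx.
  by apply: (index_inj x _ _ eq_idx); rewrite ?mem_enum.
- move=> y /= yB.
  have yi : index y (enum B) < size (enum A).
    by rewrite -cardE eqAB cardE index_mem mem_enum.
  exists (nth y (enum A) (index y (enum B))).
    by rewrite /= -mem_enum mem_nth.
  rewrite index_uniq ?enum_uniq // (set_nth_default y) ?nth_index ?mem_enum //.
  by rewrite index_mem mem_enum.
Qed.

(** This is Moebius inversion on the lattice of subsets, in the form of a
    downward induction: the elements whose value contains J split into those
    with value J and those with a strictly larger value, and the latter are
    counted by induction. *)
Lemma card_fiber_from_upper_counts (P W : finType) (B : {set W})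
    (f g : W -> {set P}) :
  (forall J : {set P},
     #|[set w in B | J \subset f w]| = #|[set w in B | J \subset g w]|) ->
  forall J : {set P}, #|[set w in B | f w == J]| = #|[set w in B | g w == J]|.
Proof.
move=> eq_up J.
have [n] := ubnP #|~: J|; elim: n J => // n IHn J ltn.
have split_up (h : W -> {set P}) : #|[set w in B | J \subset h w]| =
    #|[set w in B | h w == J]| +
    \sum_(K : {set P} | J \proper K) #|[set w in B | h w == K]|.
  rewrite -sum1dep_card (partition_big h (fun K => J \subset K)) /=; last first.
    by move=> w /andP[].
  have cardK (K : {set P}) : J \subset K ->
      \sum_(w | [&& w \in B, J \subset h w & h w == K]) 1 =
      #|[set w in B | h w == K]|.
    move=> JK; rewrite -sum1dep_card; apply: eq_bigl => w.
    by case: eqP => [->|]; rewrite ?JK ?andbF.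
  rewrite (bigD1 J) //=; congr (_ + _).
    by rewrite -cardK //; apply: eq_bigl => w; rewrite andbA.
  apply: eq_big => [K|K /andP[JK _]].
    by rewrite finset.properEneq eq_sym andbC.
  by rewrite -cardK //; apply: eq_bigl => w; rewrite andbA.
have := eq_up J; rewrite !split_up.
rewrite (eq_bigr (fun K => #|[set w in B | g w == K]|)) => [|K JK].
  exact: addIn.
apply: IHn; rewrite -ltnS; apply: leq_trans ltn; rewrite ltnS.
by apply: proper_card; rewrite finset.properC.
Qed.

Local Open Scope ring_scope.

Definition language_set (d q : nat) (X : set (config d q)) (S : {fset Zd d}) :
  {set patt q S} := [set w | `[< language X S w >]].

(** The point s of S stands for the position s - j0, where j0 is a reference
    point of U. *)
Definition occurrences (d q : nat) (S U : {fset Zd d}) (j0 : Zd d)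
    (u : patt q U) (w : patt q S) : {set S} :=
  [set s | `[< occurs_in_patt_at u w (val s - j0) >]].

Section Occurrences.

Variables (d q : nat) (X : set (config d q)) (S U : {fset Zd d}).

Lemma occurs_in_restr (u : patt q U) (x : config d q) (i : Zd d) :
  occurs_in_patt_at u (restr x S) i <->
  occurs_at u x i /\ (forall j : U, i + val j \in S).
Proof.
split=> [occ|[occ inS] j].
- by split=> j; have [k ki wk] := occ j; rewrite -ki ?(valP k) -?wk ?ffunE.
- by exists (FSetSub (inS j)); rewrite ?ffunE //= occ.
Qed.

Lemma language_avoidingE (u : patt q U) (w : patt q S) :
  language_avoiding X S u w <-> language X S w /\ ~ appears_patt u w.
Proof.
split=> [[x [Xx nux] <-]|[[x Xx <-] nux]]; last by exists x.
by split=> //; exists x.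
Qed.

(** Every occurrence is seen by [occurrences]: a translate of U inside S at i
    contains the point i + j0 of S. *)
Lemma avoids_occurrences0 (j0 : U) (u : patt q U) (w : patt q S) :
  ~ appears_patt u w <-> occurrences (val j0) u w = finset.set0.
Proof.
split=> [nu|occ0 [i occ_i]].
- apply/finset.setP => s; rewrite !inE; apply/asboolP => occ_s.
  by apply: nu; exists (val s - val j0).
- have [s si _] := occ_i j0.
  suff: s \in occurrences (val j0) u w by rewrite occ0 inE.
  by rewrite inE; apply/asboolP; rewrite si addrK.
Qed.

(** Replacing u0 by u1 at all the positions in J is an injection, since the
    original word is u0 on the marked translates of U and agrees with the new
    word elsewhere. *)
Lemma card_occurrences_le (j0 : Zd d) (u0 u1 : patt q U) :
  replaceable X u0 u1 -> forall J : {set S},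
  (#|[set w in language_set X S | J \subset occurrences j0 u0 w]| <=
   #|[set w in language_set X S | J \subset occurrences j0 u1 w]|)%N.
Proof.
move=> rep J.
pose marked (k : S) :=
  exists2 s : S, s \in J & exists j : U, val k = (val s - j0) + val j.
pose has_at_J (u : patt q U) w :=
  (w \in language_set X S) && (J \subset occurrences j0 u w).
have occ_at_J u w : has_at_J u w -> forall s, s \in J ->
    occurs_in_patt_at u w (val s - j0).
  by move=> /andP[_ /fintype.subsetP sub] s /sub; rewrite inE => /asboolP.
have replace w : exists w', has_at_J u0 w ->
    has_at_J u1 w' /\ forall k, ~ marked k -> w' k = w k.
  have [hw|_] := boolP (has_at_J u0 w); last by exists w.
  have := hw; rewrite /has_at_J inE => /andP[/asboolP [x Xx xw] _].
  pose I : set (Zd d) := fun i => exists2 s : S, s \in J & i = val s - j0.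
  have occI i : I i -> occurs_at u0 x i /\ forall j : U, i + val j \in S.
    move=> [s sJ ->]; apply/occurs_in_restr; rewrite xw.
    exact: occ_at_J hw s sJ.
  have [y [Xy occy eqy]] := rep x I Xx (fun i Ii => (occI i Ii).1).
  exists (restr y S) => _; split.
    rewrite /has_at_J inE; apply/andP; split; first by apply/asboolP; exists y.
    apply/fintype.subsetP => s sJ; rewrite inE; apply/asboolP/occurs_in_restr.
    have Is : I (val s - j0) by exists s.
    by split; [exact: occy | exact: (occI _ Is).2].
  move=> k nmk; rewrite -xw !ffunE; apply: eqy => -[_ [s sJ ->] [j jU jk]].
  by apply: nmk; exists s => //; exists (FSetSub jU).
have [phi phiP] := boolp.choice replace.
rewrite -(@card_in_imset _ _ phi) => [|w1 w2].
  apply/subset_leq_card/fintype.subsetP => _ /imsetP[w + ->].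
  by rewrite !inE => hw; have [] := phiP w; rewrite /has_at_J !inE.
rewrite !inE => hw1 hw2 eq_phi.
have {}hw1 : has_at_J u0 w1 by rewrite /has_at_J inE.
have {}hw2 : has_at_J u0 w2 by rewrite /has_at_J inE.
have [_ eq1] := phiP _ hw1; have [_ eq2] := phiP _ hw2.
apply/ffunP => k; have [[s sJ [j kE]]|nmk] := EM (marked k); last first.
  by rewrite -eq1 // -eq2 // eq_phi.
have [k1 k1E w1k] := occ_at_J _ _ hw1 s sJ j.
have [k2 k2E w2k] := occ_at_J _ _ hw2 s sJ j.
have -> : k = k1 by apply: val_inj; rewrite k1E kE.
have k12 : k1 = k2 by apply: val_inj; rewrite k1E k2E.
by rewrite w1k -w2k k12.
Qed.

End Occurrences.

Close Scope ring_scope.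

Theorem theorem5p4 (d q : nat) (hd : (1 <= d)%N) (hq : (1 <= q)%N)
    (F : set (some_patt d q)) (U : {fset Zd d}) (u0 u1 : patt q U)
    (hu0 : language (shift_space F) U u0)
    (hu1 : language (shift_space F) U u1)
    (hrep : mutually_replaceable (shift_space F) u0 u1)
    (S : {fset Zd d}) :
  exists f : patt q S -> patt q S,
    set_bij (language_avoiding (shift_space F) S u0)
            (language_avoiding (shift_space F) S u1) f.
Proof.
have [j0 _|U0] := pickP (fun _ : U => true); last first.
  have -> : u0 = u1 by apply/ffunP => j; have := U0 j.
  by exists id; split=> // w avoids_w; exists w.
have [rep01 rep10] := hrep.
set X := shift_space F.
have avoidingE (u : patt q U) : language_avoiding X S u =
    [set` [set w in language_set X S |
           occurrences (val j0) u w == finset.set0]]%classic.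
  apply/predeqP => w; rewrite /= !inE; split.
    move=> /language_avoidingE[Lw /(iffLR (avoids_occurrences0 j0 u w)) ->].
    by rewrite eqxx andbT; apply/asboolP.
  move=> /andP[/asboolP Lw /eqP occ0]; apply/language_avoidingE; split=> //.
  exact: (iffRL (avoids_occurrences0 j0 u w)).
rewrite !avoidingE; apply: set_bij_of_card_eq.
apply: card_fiber_from_upper_counts => J.
by apply/eqP; rewrite eqn_leq !card_occurrences_le.
Qed.
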